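(* Let $a,b,c$ be positive integers and consider the uniform probability measure on the set $\mathrm{LT}(a,b,c)$ of lozenge tilings of a hexagon with sides $(a,b,c,a,b,c)$. For $\ell \in [1,c]$, let $\Gamma_\ell$ be the number of left corners of height $\ell$ in a uniformly random tiling, where a left corner is a local configuration of the three lozenge types meeting as a convex corner (when the tiling is viewed in $\mathbb{R}^3$ as a pile of cubes, i.e. a boxed plane partition), and its height is the $z$-coordinate of its top tile. Then the probability generating function of $(\Gamma_1,\ldots,\Gamma_c)$ is $$ \sum_{\gamma_1, \ldots, \gamma_c \in \mathbb{N}} \mathrm{P}(\Gamma_1 = \gamma_1, \ldots, \Gamma_c = \gamma_c)\, x_1^{\gamma_1} \cdots x_c^{\gamma_c} = \frac{s_{(a^b)}(1^{b}, x_1, \ldots, x_c)}{s_{(a^b)}(1^{b+c})}, $$ where $s_{(a^b)}$ is the Schur polynomial indexed by the rectangular partition with $b$ parts equal to $a$, and $1^n$ denotes $n$ variables equal to $1$.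
   Context: $\mathbb{N}=\{0,1,2,\ldots\}$. The uniform measure on $\mathrm{LT}(a,b,c)$ corresponds bijectively to the uniform measure on boxed plane partitions $\mathrm{PP}(a,b,c)$ (via recording heights of top tiles), under which $\Gamma_\ell$ equals the number of columns of the plane partition containing the entry $\ell$. The right-hand side is the normalized Schur polynomial $S_{(a^b)}(x_1,\ldots,x_c;\,b+c)$, and $s_{(a^b)}(1^{b+c})=|\mathrm{PP}(a,b,c)|$.
   Formalization: A left corner is taken to be a top and a left lozenge meeting along a convex edge (one per column containing ℓ), not all three lozenge types meeting at a corner; with all three the formula fails for a=2, b=c=1. *)

(* Defs.v *)
From mathcomp Require Import all_boot all_order all_algebra.
From mathcomp Require Import mpoly.
Set Implicit Arguments.
Unset Strict Implicit.
Unset Printing Implicit Defensive.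
Import GRing.Theory.

(* Coordinates.  The space Z^3, with the box [0,b] x [0,a] x [0,c], is projected
   along (1,1,1) to the triangular lattice by
       (x, y, z) |-> (p, q) = (b + z - x, a + z - y).
   In the usual picture (x-axis to the lower left, y-axis to the lower right,
   z-axis upwards) a unit step in p is drawn up-right, a unit step in q up-left,
   and the step (1, 1), i.e. the z-direction, vertically upwards. *)

Section Tilings.
Variables a b c : nat.

(* Lattice points of the hexagon.  Its corners are, counterclockwise,
     (0,a), (0,0), (b,0), (b+c,c), (b+c,a+c), (c,a+c),
   so its successive sides have lengths a, b, c, a, b, c; the side of length a
   is the lower left one. *)
Definition in_hexagon (v : nat * nat) : bool :=
  [&& v.1 <= b + c, v.2 <= a + c, v.2 <= v.1 + a & v.1 <= v.2 + b].

(* Unit triangles: each square [p,p+1] x [q,q+1] is cut by the vertical edge from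
   (p,q) to (p+1,q+1).  The boolean is true for the triangle to the left of this
   edge (third vertex (p,q+1)) and false for the one to its right (third vertex
   (p+1,q)).  The index range exceeds the hexagon so that no lozenge with its
   lowest vertex in range is truncated by [inord]. *)
Definition triangle : finType := ('I_(b + c).+1 * 'I_(a + c).+1 * bool)%type.

Definition tri (p q : nat) (d : bool) : triangle := (inord p, inord q, d).

Definition vertices (t : triangle) : seq (nat * nat) :=
  let: (p, q, d) := t in
  [:: (p : nat, q : nat); (p.+1, q.+1);
      if d then (p : nat, q.+1) else (p.+1, q : nat)].

Definition hexagon : {set triangle} := [set t | all in_hexagon (vertices t)].

(* The three lozenges whose lowest vertex is (p, q):
   - top   : sides in the x- and y-directions (horizontal face of a cube);
   - left  : sides in the y- and z-directions;
   - right : sides in the x- and z-directions. *)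
Definition top_tile (p q : nat) : {set triangle} :=
  [set tri p q true; tri p q false].
Definition left_tile (p q : nat) : {set triangle} :=
  [set tri p q true; tri p q.+1 false].
Definition right_tile (p q : nat) : {set triangle} :=
  [set tri p q false; tri p.+1 q true].

Definition lozenge (B : {set triangle}) : bool :=
  [exists p : 'I_(b + c), exists q : 'I_(a + c),
    [|| B == top_tile p q, B == left_tile p q | B == right_tile p q]].

Definition LT : {set {set {set triangle}}} :=
  [set P : {set {set triangle}} |
    partition P hexagon && [forall (B | B \in P), lozenge B]].

(* The z-coordinate of the top tile of P with lowest vertex (p, q).  The left half
   of this tile lies in the vertical strip p - q - 1 <= p' - q' <= p - q, between
   two vertical lattice lines.  Climbing this strip from its lowest point, which
   lies on the floor z = 0 of the box, the stepped surface rises by one unit across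
   each left or right tile and stays level across each half of a top tile.  So the
   z-coordinate is the number of left and right tiles of the strip that lie below
   the top tile. *)
Definition height (P : {set {set triangle}}) (p q : nat) : nat :=
  #|[set v : 'I_(b + c) * 'I_(a + c) | (v.2 < q) &&
     (((p + v.2 == v.1 + q) && (left_tile v.1 v.2 \in P))
      || ((p + v.2 == v.1.+1 + q) && (right_tile v.1 v.2 \in P)))]|.

(* A left corner is a top tile and a left tile meeting along the lower left edge
   of the top tile, i.e. along a convex edge of the pile of cubes; the left tile
   adjacent to the top tile at (p+1, q+1) is the one at (p, q).  In terms of the
   plane partition pi (b rows in the x-direction, a columns in the y-direction),
   left corners of height l are the cells with pi(i,j) = l > pi(i+1,j), one for
   each column containing l. *)
Definition left_corner (P : {set {set triangle}}) (p q : nat) : bool :=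
  (top_tile p.+1 q.+1 \in P) && (left_tile p q \in P).

Definition Gamma (P : {set {set triangle}}) (l : nat) : nat :=
  #|[set v : 'I_(b + c) * 'I_(a + c) |
     left_corner P v.1 v.2 && (height P v.1.+1 v.2.+1 == l)]|.

End Tilings.

Definition unif_prob (F : fieldType) (T : finType) (Omega : {set T})
    (E : pred T) : F :=
  (#|[set w in Omega | E w]|%:R / #|Omega|%:R)%R.

(* Schur polynomials as generating functions of semistandard tableaux.  The shape
   lam is meant to be a partition, so that its largest part is its head. *)
Definition cell (lam : seq nat) : finType :=
  {u : 'I_(size lam) * 'I_(head 0 lam) | u.2 < nth 0 lam u.1}.

Definition semistandard (lam : seq nat) (n : nat)
    (T : {ffun cell lam -> 'I_n}) : bool :=
  [forall u : cell lam, forall v : cell lam,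
    [&& ((val u).1 == (val v).1) && ((val u).2 < (val v).2) ==> (T u <= T v)
      & ((val u).2 == (val v).2) && ((val u).1 < (val v).1) ==> (T u < T v)]].

Definition schur (R : comNzRingType) (n : nat) (lam : seq nat) : {mpoly R[n]} :=
  (\sum_(T : {ffun cell lam -> 'I_n} | semistandard T)
     \prod_(u : cell lam) 'X_(T u))%R.

(* Main.v *)
(* Let M(x, z) be the number of unit cubes (x, y, z) of the pile with x and z
   fixed.  The left corners of height z + 1 in the slice x number
   M(x, z) - max(M(x+1, z), M(x, z+1)), so that M is the array of last passage
   times of its matrix of left corner counts, and the tilings correspond to the
   b x c arrays with entries at most a that decrease along rows and columns.
   Replaying the local rules of RSK on M as a sequence of piecewise linear toggles
   turns the column sums of this matrix into differences of successive diagonal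
   sums, while the largest entry M(0, 0) <= a is left alone.  Cutting such an array
   along its diagonals gives the complement in the rectangle of the Gelfand-Tsetlin
   pattern of a semistandard tableau of shape (a^b) whose letter b + z + 1 occurs
   as often as the diagonal sums differ. *)

Require Import Defs.
From mathcomp Require Import all_boot all_order all_algebra.
From mathcomp Require Import classical_sets fsbigop.
From mathcomp Require Import mpoly.
From mathcomp Require Import zify.
Import Order.TTheory GRing.Theory Num.Theory.
Set Implicit Arguments.
Unset Strict Implicit.
Unset Printing Implicit Defensive.
Local Open Scope ring_scope.

(** * Counting along decreasing predicates *)

Section Counting.
Local Open Scope nat_scope.

Definition cnt (n : nat) (P : pred nat) : nat := \sum_(k < n) P k.

Lemma eq_cnt n (P Q : pred nat) :
  (forall k, k < n -> P k = Q k) -> cnt n P = cnt n Q.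
Proof. by move=> PQ; apply: eq_bigr => k _; rewrite PQ. Qed.

Lemma cnt_le n (P : pred nat) : cnt n P <= n.
Proof.
rewrite /cnt -[X in _ <= X]card_ord -sum1_card.
by apply: leq_sum => k _; case: (P k).
Qed.

Lemma leq_cnt n (P Q : pred nat) :
  (forall k, P k -> Q k) -> cnt n P <= cnt n Q.
Proof. by move=> PQ; apply: leq_sum => k _; have := PQ k; case: (P k) => // ->. Qed.

(** A predicate closed downwards holds on an initial segment, whose length is the count. This turns
    counts back into the conditions counted, and underlies every inversion between arrays, tableaux
    and heights. *)
Lemma cnt_lt n (P : pred nat) k :
  (forall i, P i.+1 -> P i) -> (k < cnt n P) = (k < n) && P k.
Proof.
move=> dP; have dP' i j : i <= j -> P j -> P i.
  by move=> /subnK <-; elim: (j - i) => //= m IHm /dP.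
elim: n => [|n IHn]; first by rewrite /cnt big_ord0.
rewrite /cnt big_ord_recr /= -/(cnt n P).
have [Pn|/negPf nPn] := boolP (P n); last first.
  rewrite addn0 IHn ltnS (leq_eqVlt k n).
  by case: eqP => //= ->; rewrite nPn ltnn.
suff ->: cnt n P = n.
  by rewrite addn1 ltnS; case: leqP => // /dP' ->.
transitivity (\sum_(k < n) 1); last by rewrite sum1_card card_ord.
by apply: eq_bigr => i _; rewrite (dP' _ n (ltnW (ltn_ord i)) Pn).
Qed.

Lemma cnt_ltn n m : cnt n (fun k => k < m) = minn n m.
Proof.
have P k : (k < cnt n (fun k => k < m)) = (k < minn n m).
  by rewrite cnt_lt ?leq_min // => i /ltnW.
by apply/eqP; rewrite eqn_leq leqNgt P ltnn /= leqNgt -P ltnn.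
Qed.

End Counting.

(** * Decreasing arrays and the local rules of RSK *)

Section Arrays.
Local Open Scope nat_scope.
Variables a b c : nat.

Definition arr : finType := {ffun 'I_b * 'I_c -> 'I_a.+1}.

(** Reading 0 outside the rectangle extends the array to the whole quadrant, so that cells on the
    border obey the same rules as inner ones. *)
Definition entry (M : arr) (i j : nat) : nat :=
  match insub i, insub j with Some i', Some j' => M (i', j') : nat | _, _ => 0 end.

Definition mkarr (f : nat -> nat -> nat) : arr :=
  [ffun u : 'I_b * 'I_c => inord (f u.1 u.2)].

Lemma entry_ord M (i : 'I_b) (j : 'I_c) : entry M i j = M (i, j).
Proof. by rewrite /entry !valK. Qed.

Lemma entry_out M i j : ~~ ((i < b) && (j < c)) -> entry M i j = 0.
Proof.
rewrite /entry; case: (ltnP i b) => [ib|ib]; last by rewrite insubF //; lia.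
by rewrite /= => jc; case: insubP => //= ? _ _; rewrite insubF //; lia.
Qed.

Lemma entry_le M i j : entry M i j <= a.
Proof.
rewrite /entry; case: insubP => //= i' _ _; case: insubP => //= j' _ _.
by rewrite -ltnS.
Qed.

Lemma entry_mkarr f i j : i < b -> j < c -> f i j <= a -> entry (mkarr f) i j = f i j.
Proof.
move=> ib jc fa; rewrite -[i]/(val (Ordinal ib)) -[j]/(val (Ordinal jc)).
by rewrite entry_ord ffunE inordK.
Qed.

Lemma entry_inj M N :
  (forall i j, i < b -> j < c -> entry M i j = entry N i j) -> M = N.
Proof.
move=> MN; apply/ffunP => -[i j]; apply: val_inj.
by rewrite /= -!entry_ord MN.
Qed.

Definition decr (M : arr) : bool :=
  [forall i : 'I_b, forall j : 'I_c,
    (entry M i.+1 j <= entry M i j) && (entry M i j.+1 <= entry M i j)].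

Lemma decrP M :
  reflect (forall i j, entry M i.+1 j <= entry M i j /\ entry M i j.+1 <= entry M i j)
          (decr M).
Proof.
apply: (iffP forallP) => [dM i j|dM i]; last first.
  by apply/forallP => j; apply/andP; apply: dM.
have [/andP[ib jc]|out] := boolP ((i < b) && (j < c)).
  by have /forallP/(_ (Ordinal jc))/andP[] := dM (Ordinal ib).
by rewrite !entry_out //; lia.
Qed.

Lemma decr_entry M i i' j j' : decr M -> i <= i' -> j <= j' ->
  entry M i' j' <= entry M i j.
Proof.
move=> /decrP dM /subnK <- /subnK <-; apply: (@leq_trans (entry M i (j' - j + j))).
  by elim: (i' - i) => // m IHm; apply: leq_trans IHm; have [] := dM (m + i) (j' - j + j).
by elim: (j' - j) => // m IHm; apply: leq_trans IHm; have [] := dM i (m + j).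
Qed.

Definition corner_incr (M : arr) i z : nat :=
  entry M i z - maxn (entry M i.+1 z) (entry M i z.+1).

(** For decreasing [M] this is the sum of the diagonal from [(i, z)] minus that of the diagonal from
    [(i, z.+1)]; after [b] steps both have left the array. *)
Definition diag_incr (M : arr) i z : nat :=
  \sum_(k < b) (entry M (i + k) (z + k) - entry M (i + k) (z + k).+1).

(* The local rule of RSK: reflects the entries strictly below (i, z) on its
   diagonal in the intervals left by their neighbours, which lie on other
   diagonals, so that this is an involution of the decreasing arrays. *)
Definition toggle i z (M : arr) : arr :=
  mkarr (fun p q => if (p + z == q + i) && (i < p) then
      maxn (entry M p.+1 q) (entry M p q.+1)
      + minn (entry M p.-1 q) (entry M p q.-1) - entry M p q
    else entry M p q).

Lemma entry_toggle i z M p q : decr M ->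
  entry (toggle i z M) p q =
  if [&& p < b, q < c, p + z == q + i & i < p] then
      maxn (entry M p.+1 q) (entry M p q.+1)
      + minn (entry M p.-1 q) (entry M p q.-1) - entry M p q
    else entry M p q.
Proof.
move=> /decrP dM.
case: (ltnP p b) => pb /=; last by rewrite !entry_out //; lia.
case: (ltnP q c) => qc /=; last by rewrite !entry_out //; lia.
rewrite entry_mkarr //; case: ifP => // _; last exact: entry_le.
by have := dM p q; have := entry_le M p.-1 q; lia.
Qed.

Lemma toggle_decr i z M : decr M -> decr (toggle i z M).
Proof.
move=> dM; have /decrP dM' := dM; apply/decrP => p q.
rewrite !entry_toggle //.
have := dM' p q; have := dM' p.+1 q; have := dM' p q.+1.
have := dM' p.-1 q; have := dM' p q.-1; have := dM' p.-1 q.+1; have := dM' p.+1 q.-1.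
have := @entry_out M p.+1 q; have := @entry_out M p q.+1.
case: p => [|p]; case: q => [|q] /=; split; repeat case: ifP; lia.
Qed.

Lemma toggle_neigh i z M p q : decr M -> p + z != q + i ->
  entry (toggle i z M) p q = entry M p q.
Proof. by move=> dM pq; rewrite entry_toggle // (negPf pq) !andbF. Qed.

Lemma toggleK i z M : decr M -> toggle i z (toggle i z M) = M.
Proof.
move=> dM; have /decrP dM' := dM; apply: entry_inj => p q pb qc.
rewrite entry_toggle ?toggle_decr //; case: ifP => [pq|npq]; last first.
  by rewrite entry_toggle // npq.
rewrite [entry _ p q]entry_toggle // pq !toggle_neigh //; try lia.
have := dM' p q; have := dM' p.-1 q; have := dM' p q.-1.
case: p q pb qc pq => [|p] [|q] /=; lia.
Qed.

(** The maximum and the minimum of two numbers add up to their sum, so the toggled diagonal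
    telescopes against the one starting a row lower. *)
Lemma diag_incr_toggle i z M : decr M ->
  diag_incr (toggle i z M) i z = corner_incr M i z + diag_incr M i.+1 z.
Proof.
move=> dM; have /decrP dM' := dM.
pose f k := entry (toggle i z M) (i + k) (z + k)
            - entry (toggle i z M) (i + k) (z + k).+1.
pose g k := entry M (i.+1 + k) (z + k) - entry M (i.+1 + k) (z + k).+1.
(* The remainder of the telescoping: each new toggled entry gives [r n + f n.+1 = g n + r n.+1]. *)
pose r k := maxn (entry M (i.+1 + k) (z + k)) (entry M (i + k) (z + k).+1)
            - entry M (i + k) (z + k).+1.
have step n : \sum_(k < n.+1) f k = corner_incr M i z + \sum_(k < n) g k + r n.
  elim: n => [|n IHn].
    rewrite big_ord_recr !big_ord0 /= add0n addn0 /f /r /corner_incr !addn0.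
    rewrite !entry_toggle // ltnn !andbF /=.
    have := dM' i z; lia.
  rewrite big_ord_recr IHn [in RHS]big_ord_recr /= /f /g /r.
  rewrite [entry (toggle i z M) _ (z + n.+1).+1]toggle_neigh //; last lia.
  rewrite entry_toggle // !addnS !addSn /=.
  have := dM' (i + n).+1 (z + n).+1; have := dM' (i + n).+1 (z + n).
  have := dM' (i + n) (z + n).+1.
  have := @entry_out M (i + n).+2 (z + n).+1.
  have := @entry_out M (i + n).+1 (z + n).+2.
  have := @entry_out M (i + n).+1 (z + n).+1.
  have := @entry_out M (i + n) (z + n).+1; have := @entry_out M (i + n).+1 (z + n).
  case: ifP; lia.
(* For [n = b] both [r b] and the extra term [f b] lie below the last row and vanish. *)
have := step b; rewrite big_ord_recr /= -/(diag_incr _ _ _).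
rewrite /f /r !entry_out ?subn0 ?addn0 //; lia.
Qed.

Lemma diag_incr_last z M : diag_incr M b z = 0.
Proof. by rewrite /diag_incr big1 // => k _; rewrite !entry_out //; lia. Qed.

(* Interpolates between the column sums of corner_incr and diag_incr 0: the
   columns are toggled from the last one down, each from the bottom up, and
   column z has been toggled up to row i. *)
Definition mixed_incr z i (M : arr) l : nat :=
  if l < z then \sum_(k < b) corner_incr M k l
  else if l == z then \sum_(k < i) corner_incr M k l + diag_incr M i l
  else diag_incr M 0 l.

(** The toggled entries have row above [i], column above [z], and lie on a diagonal that
    [diag_incr M 0 l] does not read for [l > z]. Hence only the diagonal term of column [z] changes,
    by [diag_incr_toggle]. *)
Lemma mixed_incr_toggle z i M l : decr M ->
  mixed_incr z i (toggle i z M) l = mixed_incr z i.+1 M l.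
Proof.
move=> dM; rewrite /mixed_incr; case: ltngtP => [lz|zl|->].
- apply: eq_bigr => k _; rewrite /corner_incr !entry_toggle //.
  by repeat (case: ifP => [?|_]; first lia).
- apply: eq_bigr => k _; rewrite !toggle_neigh //; lia.
- rewrite diag_incr_toggle // big_ord_recr /= addnA; congr (_ + _ + _).
  apply: eq_bigr => k _; rewrite /corner_incr !entry_toggle //.
  by have := ltn_ord k; repeat (case: ifP => [?|_]; first lia).
Qed.

Lemma mixed_incr_next z M l : mixed_incr z b M l = mixed_incr z.+1 0 M l.
Proof.
rewrite /mixed_incr ltnS; case: ltngtP => //= [zl|->].
  by case: eqP => // ->; rewrite big_ord0.
by rewrite diag_incr_last addn0.
Qed.

Section GenFun.
Local Open Scope ring_scope.
Variables (R : comNzRingType) (x : 'I_c -> R).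

Definition gen_fun (e : arr -> nat -> nat) : R :=
  \sum_(M | decr M) \prod_(l < c) x l ^+ e M l.

Lemma eq_gen_fun (e e' : arr -> nat -> nat) :
  (forall M (l : 'I_c), decr M -> e M l = e' M l) -> gen_fun e = gen_fun e'.
Proof.
by move=> ee'; apply: eq_bigr => M dM; apply: eq_bigr => l _; rewrite ee'.
Qed.

(** An involution of the decreasing arrays serves as a change of summation variable. *)
Lemma gen_fun_toggle z i :
  gen_fun (mixed_incr z i) = gen_fun (mixed_incr z i.+1).
Proof.
rewrite /gen_fun (reindex_onto (toggle i z) (toggle i z)) => [|M dM]; last first.
  exact: toggleK.
apply: eq_big => [M|M /andP[dtM /eqP tK]].
  apply/andP/idP => [[/(toggle_decr i z) dM /eqP <-] //|dM].
  by rewrite toggle_decr // toggleK.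
have dM : decr M by rewrite -tK toggle_decr.
by apply: eq_bigr => l _; rewrite mixed_incr_toggle.
Qed.

(** The part of RSK that is needed: lowering [(z, i)] from [(c, 0)] to [(0, 0)] toggle by toggle
    trades column sums for diagonal differences. *)
Lemma gen_fun_corner_diag :
  gen_fun (fun M l => \sum_(i < b) corner_incr M i l)%N
  = gen_fun (fun M l => diag_incr M 0 l).
Proof.
have row z i : gen_fun (mixed_incr z i) = gen_fun (mixed_incr z 0).
  by elim: i => // i <-; rewrite -gen_fun_toggle.
have col z : gen_fun (mixed_incr z 0) = gen_fun (mixed_incr 0 0).
  elim: z => // z <-; rewrite -(row z b).
  by apply: eq_gen_fun => M l _; rewrite mixed_incr_next.
rewrite (@eq_gen_fun _ (mixed_incr c 0)) => [|M l _]; last first.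
  by rewrite /mixed_incr ltn_ord.
rewrite col; apply: eq_gen_fun => M l _.
by rewrite /mixed_incr; case: eqP => //= _; rewrite big_ord0.
Qed.

End GenFun.
End Arrays.

(** * Rectangular tableaux *)

Section Tableaux.
Local Open Scope nat_scope.
Variables a b c : nat.
Hypothesis b_gt0 : 0 < b.

Local Notation rect := (nseq b a).
Local Notation row u := (nat_of_ord (val u).1).
Local Notation col u := (nat_of_ord (val u).2).
Local Notation tableau := {ffun cell rect -> 'I_(b + c)}.

Lemma row_lt (u : cell rect) : row u < b.
Proof. by have := ltn_ord (val u).1; rewrite [X in _ < X]size_nseq. Qed.

Lemma col_lt (u : cell rect) : col u < a.
Proof. by have := valP u; rewrite /= nth_nseq row_lt. Qed.

Lemma cell_inj (u v : cell rect) : row u = row v -> col u = col v -> u = v.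
Proof.
move=> uv1 uv2; apply: val_inj; rewrite [LHS]surjective_pairing [RHS]surjective_pairing.
by congr (_, _); apply: val_inj.
Qed.

Lemma cell_exists i j : i < b -> j < a ->
  exists u : cell rect, (row u == i) && (col u == j).
Proof.
move=> ib ja; have is_ : i < size rect by rewrite size_nseq.
(* Column indices of cells are bounded by [head 0 rect], which equals [a] because [b] is
   positive. *)
have jh : j < head 0 rect by case: (b) b_gt0.
have ij : (Ordinal jh : nat) < nth 0 rect (Ordinal is_) by rewrite nth_nseq /= ib.
by exists (exist _ (Ordinal is_, Ordinal jh) ij); rewrite /= !eqxx.
Qed.

Lemma big_cell (R : Type) (idx : R) (op : Monoid.com_law idx) (F : nat -> nat -> R) :
  \big[op/idx]_(u : cell rect) F (row u) (col u) =
  \big[op/idx]_(i < b) \big[op/idx]_(j < a) F i j.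
Proof.
rewrite pair_big /=.
pose h (u : cell rect) := (Ordinal (row_lt u), Ordinal (col_lt u)).
pose g (v : 'I_b * 'I_a) := xchoose (cell_exists (ltn_ord v.1) (ltn_ord v.2)).
have gP v : row (g v) = v.1 /\ col (g v) = v.2.
  by have /andP[/eqP ? /eqP ?] := xchooseP (cell_exists (ltn_ord v.1) (ltn_ord v.2)).
rewrite (reindex h) //=; exists g => [u _|[i j] _].
  by apply: cell_inj; have [] := gP (h u).
by have [gi gj] := gP (i, j); congr (_, _); apply: val_inj.
Qed.

Definition tab_entry (T : tableau) i j : nat :=
  if [pick u : cell rect | (row u == i) && (col u == j)] is Some u then T u else 0.

Lemma tab_entryE T u : tab_entry T (row u) (col u) = T u.
Proof.
rewrite /tab_entry; case: pickP => [v /andP[/eqP vu1 /eqP vu2]|/(_ u)].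
  by rewrite (cell_inj vu1 vu2).
by rewrite !eqxx.
Qed.

Lemma tab_entry_row T i j : semistandard T -> i < b -> j.+1 < a ->
  tab_entry T i j <= tab_entry T i j.+1.
Proof.
move=> /forallP sT ib ja.
have [u /andP[/eqP u1 /eqP u2]] := cell_exists ib (ltnW ja).
have [v /andP[/eqP v1 /eqP v2]] := cell_exists ib ja.
have /forallP/(_ v)/andP[/implyP + _] := sT u.
rewrite -{1}u1 -{1}v1 -{1}u2 -{1}v2 !tab_entryE; apply.
by rewrite -val_eqE /= u1 v1 u2 v2 eqxx ltnS leqnn.
Qed.

Lemma tab_entry_col T i j : semistandard T -> i.+1 < b -> j < a ->
  tab_entry T i j < tab_entry T i.+1 j.
Proof.
move=> /forallP sT ib ja.
have [u /andP[/eqP u1 /eqP u2]] := cell_exists (ltnW ib) ja.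
have [v /andP[/eqP v1 /eqP v2]] := cell_exists ib ja.
have /forallP/(_ v)/andP[_ /implyP +] := sT u.
rewrite -{1}u1 -{1}v1 -{1}u2 -{1}v2 !tab_entryE; apply.
by rewrite -val_eqE /= u1 v1 u2 v2 eqxx ltnS leqnn.
Qed.

Lemma tab_entry_lt T i j : tab_entry T i j < b + c.
Proof. by rewrite /tab_entry; case: pickP => // _; rewrite ltn_addr. Qed.

(** Columns increase strictly: the [i] cells above force the lower bound, and the [b.-1 - i] cells
    below, ending under [b + c], force the upper one. *)
Lemma tab_entry_bounds T i j : semistandard T -> i < b -> j < a ->
  i <= tab_entry T i j <= i + c.
Proof.
move=> sT ib ja.
have low k : k < b -> k <= tab_entry T k j.
  by elim: k => // k IHk kb; apply: leq_ltn_trans (IHk (ltnW kb)) (tab_entry_col sT kb ja).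
have up k : i + k < b -> tab_entry T i j + k <= tab_entry T (i + k) j.
  elim: k => [|k IHk]; first by rewrite !addn0.
  rewrite !addnS => kb.
  exact: leq_ltn_trans (IHk (ltnW kb)) (tab_entry_col sT kb ja).
rewrite low //=; have := up (b.-1 - i); have := tab_entry_lt T (i + (b.-1 - i)) j.
lia.
Qed.

(* Subtracting its index i from each row i of a tableau leaves a reverse plane
   partition with entries at most c; entry (k, s) of the array counts the entries
   larger than s in the k-th row from the bottom. *)
Definition arr_of_tab (T : tableau) : arr a b c :=
  mkarr a b c (fun k s =>
    cnt a (fun j => s + (b.-1 - k) < tab_entry T (b.-1 - k) (a.-1 - j))).

(** Conjugates back: the count recovers a letter minus its row index, and [i] restores the letter.
    Rows and columns are read in reverse, as in [arr_of_tab]. *)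
Definition tab_value (M : arr a b c) i j : nat :=
  i + cnt c (fun s => a.-1 - j < entry M (b.-1 - i) s).

Lemma tab_value_lt M (u : cell rect) : tab_value M (row u) (col u) < b + c.
Proof.
have := cnt_le c (fun s => a.-1 - col u < entry M (b.-1 - row u) s).
by rewrite /tab_value; have := row_lt u; lia.
Qed.

Definition tab_of_arr (M : arr a b c) : tableau :=
  [ffun u => Ordinal (tab_value_lt M u)].

Lemma lt_arr_of_tab T k s j : semistandard T -> k < b -> s < c -> j < a ->
  (j < entry (arr_of_tab T) k s)
  = (s + (b.-1 - k) < tab_entry T (b.-1 - k) (a.-1 - j)).
Proof.
move=> sT kb sc ja; rewrite entry_mkarr ?cnt_le // cnt_lt ?ja // => m lt_m.
have [ma|am] := ltnP m.+1 a; last first.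
  by have -> : a.-1 - m = a.-1 - m.+1 by lia.
apply: leq_trans lt_m _; have -> : a.-1 - m = (a.-1 - m.+1).+1 by lia.
apply: tab_entry_row => //; lia.
Qed.

(** Going one row up in the tableau lowers the threshold by one, which strict growth down the
    columns compensates. *)
Lemma arr_of_tab_decr T : semistandard T -> decr (arr_of_tab T).
Proof.
move=> sT; apply/decrP => k s; split; rewrite leqNgt; apply/negP => lt_e.
  have [kb|bk] := ltnP k.+1 b; last by rewrite [entry _ k.+1 s]entry_out in lt_e; lia.
  have [sc|cs] := ltnP s c; last by rewrite [entry _ k.+1 s]entry_out in lt_e; lia.
  have ja := leq_trans lt_e (entry_le _ _ _).
  move: lt_e; rewrite lt_arr_of_tab // => lt_e.
  suff : entry (arr_of_tab T) k s < entry (arr_of_tab T) k s by rewrite ltnn.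
  rewrite lt_arr_of_tab //; last exact: ltnW.
  have -> : b.-1 - k = (b.-1 - k.+1).+1 by lia.
  rewrite addnS; apply: leq_ltn_trans lt_e (tab_entry_col sT _ _); lia.
have [kb|bk] := ltnP k b; last by rewrite [entry _ k s.+1]entry_out in lt_e; lia.
have [sc|cs] := ltnP s.+1 c; last by rewrite [entry _ k s.+1]entry_out in lt_e; lia.
have ja := leq_trans lt_e (entry_le _ _ _).
move: lt_e; rewrite lt_arr_of_tab // => lt_e.
suff : entry (arr_of_tab T) k s < entry (arr_of_tab T) k s by rewrite ltnn.
by rewrite lt_arr_of_tab //; lia.
Qed.

Lemma tab_of_arr_semistandard M : decr M -> semistandard (tab_of_arr M).
Proof.
move=> dM; apply/forallP => u; apply/forallP => v; apply/andP; split; apply/implyP.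
  move=> /andP[/eqP uv1 uv2]; rewrite !ffunE /= /tab_value uv1 leq_add2l.
  by apply: leq_cnt => s; apply: leq_ltn_trans; apply: leq_sub2l; apply: ltnW.
move=> /andP[/eqP uv2 uv1]; rewrite !ffunE /= /tab_value uv2.
apply: leq_ltn_trans (_ : row u + cnt c (fun s => a.-1 - col v < entry M (b.-1 - row v) s) < _).
  rewrite leq_add2l; apply: leq_cnt => s lt_s; apply: leq_trans lt_s _.
  by apply: decr_entry => //; apply: leq_sub2l; apply: ltnW.
by rewrite ltn_add2r.
Qed.

Lemma tab_entry_of_arr M i j : i < b -> j < a ->
  tab_entry (tab_of_arr M) i j = tab_value M i j.
Proof.
move=> ib ja; have [u /andP[/eqP <- /eqP <-]] := cell_exists ib ja.
by rewrite tab_entryE ffunE.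
Qed.

Lemma tab_of_arrK M : decr M -> arr_of_tab (tab_of_arr M) = M.
Proof.
move=> dM; apply: entry_inj => k s kb sc; rewrite entry_mkarr ?cnt_le //.
transitivity (cnt a (fun j => j < entry M k s)); last first.
  by rewrite cnt_ltn; apply/minn_idPr/entry_le.
apply: eq_cnt => j ja; rewrite tab_entry_of_arr; [|lia..].
rewrite /tab_value addnC ltn_add2l cnt_lt ?sc /= => [|m]; last first.
  by move/leq_trans; apply; apply: decr_entry.
by congr (_ < entry M _ _); lia.
Qed.

Lemma arr_of_tabK T : semistandard T -> tab_of_arr (arr_of_tab T) = T.
Proof.
move=> sT; apply/ffunP => u; apply: val_inj; rewrite ffunE /= /tab_value.
have ru := row_lt u; have cu := col_lt u.
have := tab_entry_bounds sT ru cu; rewrite tab_entryE => /andP[lo up].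
rewrite (@eq_cnt _ _ (fun s => s < T u - row u)) => [|s sc].
  by rewrite cnt_ltn (minn_idPr _) ?subnKC // leq_subLR.
rewrite lt_arr_of_tab //; [|lia..].
have le_pred m n : m < n -> m <= n.-1 by lia.
rewrite !subKn ?le_pred // tab_entryE.
by rewrite ltn_subRL addnC.
Qed.

(** Letters start at 0. In the [k]-th row from the bottom a cell holds [b + l] exactly when its
    count is [l + k + 1], that is, when its column index from the right lies between
    [entry M k (l + k).+1] and [entry M k (l + k)]; this gives the [k]-th term of [diag_incr]. *)
Lemma content_tab_of_arr M l : decr M ->
  \sum_(u : cell rect) (tab_of_arr M u == b + l :> nat) = diag_incr M 0 l.
Proof.
move=> dM.
transitivity (\sum_(u : cell rect) (tab_value M (row u) (col u) == b + l)).
  by apply: eq_bigr => u _; rewrite ffunE.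
rewrite (big_cell _ (fun i j => (tab_value M i j == b + l) : nat)).
rewrite (reindex_inj rev_ord_inj); apply: eq_bigr => k _ /=.
rewrite add0n (reindex_inj rev_ord_inj) /=.
set A := entry M k (l + k); set B := entry M k (l + k).+1.
have BA : B <= A by apply: decr_entry.
have AE : A = cnt a (fun j => j < A) by rewrite cnt_ltn; apply/esym/minn_idPr/entry_le.
have BE : B = cnt a (fun j => j < B) by rewrite cnt_ltn; apply/esym/minn_idPr/entry_le.
(* Moving [B] to the other side avoids truncated subtraction and lets the three counts be compared
   column by column. *)
apply/eqP; rewrite -(eqn_add2r B) subnK // {1}BE {1}AE -big_split /=; apply/eqP.
apply: eq_bigr => j _; rewrite /tab_value.
have -> : b.-1 - (b - k.+1) = k by have := ltn_ord k; lia.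
have -> : a.-1 - (a - j.+1) = j by have := ltn_ord j; lia.
have lt_cnt m : (m < cnt c (fun s => j < entry M k s)) = (j < entry M k m).
  rewrite cnt_lt => [|s]; last by move/leq_trans; apply; apply: decr_entry.
  by case: ltnP => //= cm; rewrite entry_out //; lia.
have := lt_cnt (l + k); have := lt_cnt (l + k).+1.
rewrite -/A -/B => <- <-; set n := cnt _ _.
have /= kb := ltn_ord k.
by case: eqP; case: ltnP; case: ltnP => /=; lia.
Qed.

Section Evaluation.
Local Open Scope ring_scope.
Variables (R : comNzRingType) (x : 'I_c -> R).

Lemma schur_rect :
  (schur R (b + c) rect).@[fun i => match split i with inl _ => 1 | inr l => x l end]
  = gen_fun x (fun (M : arr a b c) l => diag_incr M 0 l).
Proof.
rewrite /schur rmorph_sum /=.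
rewrite (reindex_onto tab_of_arr arr_of_tab) => [|T sT]; last exact: arr_of_tabK.
apply: eq_big => [M|M /andP[sM /eqP tK]].
  apply/andP/idP => [[/arr_of_tab_decr dM /eqP <-] //|dM].
  by rewrite tab_of_arr_semistandard // tab_of_arrK.
have dM : decr M by rewrite -tK arr_of_tab_decr.
rewrite rmorph_prod /=.
under eq_bigr do rewrite mevalXU.
(* Exponents 0 or 1 express the variable of each cell; the first [b] letters evaluate to 1 and match
   no [l]. *)
transitivity (\prod_(u : cell rect) \prod_(l < c) x l ^+ (tab_of_arr M u == b + l :> nat)%N).
  apply: eq_bigr => u _; case: (splitP (tab_of_arr M u)) => [i uE|l uE].
    rewrite big1 // => l _; case: eqP => // El.
    by have := ltn_ord i; rewrite -uE El ltnNge leq_addr.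
  rewrite (bigD1 l) //= uE eqxx expr1 big1 ?mulr1 // => l' /negPf ll'.
  by rewrite eqn_add2l val_eqE eq_sym ll'.
rewrite exchange_big; apply: eq_bigr => l _ /=.
by rewrite prodrXr content_tab_of_arr.
Qed.

End Evaluation.
End Tableaux.

(** * Tilings as choices of lozenges *)

Section TilingCodes.
Local Open Scope nat_scope.
Variables a b c : nat.

Local Notation tri := (tri a b c).
Local Notation top_tile := (top_tile a b c).
Local Notation left_tile := (left_tile a b c).
Local Notation right_tile := (right_tile a b c).
Local Notation hexagon := (hexagon a b c).
Local Notation inhex p q := (in_hexagon a b c (p, q)).

Definition hextri p q (d : bool) : bool :=
  if d then [&& p < b + c, q < a + c, q < p + a & p <= q + b]
  else [&& p < b + c, q < a + c, q <= p + a & p < q + b].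

Lemma tri_surj (t : triangle a b c) :
  exists p q d, [/\ t = tri p q d, p <= b + c & q <= a + c].
Proof.
case: t => [[p q] d]; exists (p : nat), (q : nat), d.
by rewrite -ltnS ltn_ord -ltnS ltn_ord /Defs.tri !inord_val.
Qed.

Lemma tri_hexagon p q d : p <= b + c -> q <= a + c ->
  (tri p q d \in hexagon) = hextri p q d.
Proof.
move=> pb qa; rewrite inE /= !inordK // /in_hexagon /hextri /=.
by case: d => /=; lia.
Qed.

Lemma tri_eq p q d p' q' d' :
  p <= b + c -> q <= a + c -> p' <= b + c -> q' <= a + c ->
  (tri p q d == tri p' q' d') = [&& p == p', q == q' & d == d'].
Proof. by move=> *; rewrite /Defs.tri !xpair_eqE -!val_eqE /= !inordK // andbA. Qed.

Lemma mem_top p q p' q' d : p < b + c -> q < a + c -> p' <= b + c -> q' <= a + c ->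
  (tri p' q' d \in top_tile p q) = (p' == p) && (q' == q).
Proof.
move=> pb qa pb' qa'; have pb1 := ltnW pb; have qa1 := ltnW qa.
by rewrite !inE !tri_eq //; case: d => /=; lia.
Qed.

Lemma mem_left p q p' q' d : p < b + c -> q < a + c -> p' <= b + c -> q' <= a + c ->
  (tri p' q' d \in left_tile p q) = (p' == p) && (q' == q + ~~ d).
Proof.
move=> pb qa pb' qa'; have pb1 := ltnW pb; have qa1 := ltnW qa.
by rewrite !inE !tri_eq //; case: d => /=; lia.
Qed.

Lemma mem_right p q p' q' d : p < b + c -> q < a + c -> p' <= b + c -> q' <= a + c ->
  (tri p' q' d \in right_tile p q) = (p' == p + d) && (q' == q).
Proof.
move=> pb qa pb' qa'; have pb1 := ltnW pb; have qa1 := ltnW qa.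
by rewrite !inE !tri_eq //; case: d => /=; lia.
Qed.

(** The range conditions exclude indices at which [inord] would fall back on 0 and produce a set
    unrelated to the position [(p, q)]. *)
Definition has_top (P : {set {set triangle a b c}}) p q :=
  [&& p < b + c, q < a + c & top_tile p q \in P].
Definition has_left (P : {set {set triangle a b c}}) p q :=
  [&& p < b + c, q < a + c & left_tile p q \in P].
Definition has_right (P : {set {set triangle a b c}}) p q :=
  [&& p < b + c, q < a + c & right_tile p q \in P].

(* [top p q], [left p q], [right p q] tell whether the lozenge of that type with
   lowest vertex (p, q) belongs to the tiling; each unit triangle of the hexagon
   lies in at most three lozenges, exactly one of which must be present. *)
Record tiling_code (top left right : nat -> nat -> bool) : Prop := TilingCode {
  code_top p q : top p q -> hextri p q true && hextri p q false;
  code_left p q : left p q -> hextri p q true && hextri p q.+1 false;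
  code_right p q : right p q -> hextri p q false && hextri p.+1 q true;
  code_true p q : hextri p q true ->
    top p q + left p q + (if p is p'.+1 then right p' q else false) = 1;
  code_false p q : hextri p q false ->
    top p q + right p q + (if q is q'.+1 then left p q' else false) = 1 }.

(** Covering gives at least one lozenge on each triangle, and disjointness at most one. *)
Lemma LT_code P : P \in LT a b c ->
  tiling_code (has_top P) (has_left P) (has_right P).
Proof.
rewrite inE => /andP[/and3P[/eqP covP /finset.trivIsetP trivP _] /forallP lozP].
have hexP B t : B \in P -> t \in B -> t \in hexagon.
  by move=> BP tB; rewrite -covP; apply/bigcupP; exists B.
have uniqP A B t : A \in P -> B \in P -> t \in A -> t \in B -> A = B.
  move=> AP BP tA tB; apply/eqP/negPn/negP => /(trivP _ _ AP BP).
  by move/disjoint_setI0/setP/(_ t); rewrite !inE tA tB.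
have exP t : t \in hexagon -> exists2 B, B \in P & t \in B.
  by rewrite -covP => /bigcupP.
split=> p q.
- move=> /and3P[pb qa tP].
  rewrite -!tri_hexagon ?(ltnW pb) ?(ltnW qa) //.
  by rewrite !(hexP _ _ tP) // mem_top ?eqxx // ltnW.
- move=> /and3P[pb qa tP].
  rewrite -!tri_hexagon ?(ltnW pb) ?(ltnW qa) //.
  by rewrite !(hexP _ _ tP) // mem_left /= ?addn0 ?addn1 ?eqxx // ltnW.
- move=> /and3P[pb qa tP].
  rewrite -!tri_hexagon ?(ltnW pb) ?(ltnW qa) //.
  by rewrite !(hexP _ _ tP) // mem_right /= ?addn0 ?addn1 ?eqxx // ltnW.
- move=> hex; have /and4P[pb qa _ _] := hex; have [pb' qa'] := (ltnW pb, ltnW qa).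
  have [B BP tB] : exists2 B, B \in P & tri p q true \in B.
    by apply: exP; rewrite tri_hexagon.
  (* Two lozenges of [P] sharing a triangle coincide; a second triangle, contained in only one of
     them, refutes this. The other exclusions go the same way. *)
  have ntl : ~~ (has_top P p q && has_left P p q).
    apply/negP => /andP[/and3P[_ _ tP] /and3P[_ _ lP]].
    have /setP/(_ (tri p q false)) : top_tile p q = left_tile p q.
      by apply: (uniqP _ _ (tri p q true)); rewrite ?mem_top ?mem_left ?addn0 ?eqxx.
    by rewrite mem_top ?mem_left // !eqxx; lia.
  have ntr p' : p = p'.+1 -> ~~ (has_top P p q && has_right P p' q).
    move=> pE; apply/negP => /andP[/and3P[_ _ tP] /and3P[pb2 _ lP]].
    have /setP/(_ (tri p q false)) : top_tile p q = right_tile p' q.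
      by apply: (uniqP _ _ (tri p q true)); rewrite ?mem_top ?mem_right ?pE ?addn1 ?eqxx // -pE.
    by rewrite mem_top ?mem_right // !eqxx; lia.
  have nlr p' : p = p'.+1 -> ~~ (has_left P p q && has_right P p' q).
    move=> pE; apply/negP => /andP[/and3P[_ _ tP] /and3P[pb2 _ lP]].
    have /setP/(_ (tri p q.+1 false)) : left_tile p q = right_tile p' q.
      by apply: (uniqP _ _ (tri p q true)); rewrite ?mem_left ?mem_right ?pE ?addn0 ?addn1 ?eqxx // -pE.
    by rewrite mem_left ?mem_right // !eqxx; lia.
  have /existsP[p1 /existsP[q1 /or3P E]] := implyP (lozP B) BP.
  have [lp1 lq1] := (ltn_ord p1, ltn_ord q1).
  case: E => /eqP BE; move: tB; rewrite BE.
  + rewrite mem_top // => /andP[/eqP pE /eqP qE].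
    have T : has_top P p q by rewrite /has_top pb qa pE qE -BE.
    move: ntl ntr; rewrite T /= => /negPf ->.
    by case: (p) => // p' /(_ p' erefl) /negPf ->.
  + rewrite mem_left // addn0 => /andP[/eqP pE /eqP qE].
    have T : has_left P p q by rewrite /has_left pb qa pE qE -BE.
    move: ntl nlr; rewrite T andbT /= => /negPf ->.
    by case: (p) => // p' /(_ p' erefl) /negPf ->.
  + rewrite mem_right // addn1 => /andP[/eqP pE /eqP qE].
    have T : has_right P p1 q by rewrite /has_right lp1 qa qE -BE.
    move: (ntr _ pE) (nlr _ pE); rewrite T !andbT => /negPf -> /negPf ->.
    by rewrite pE T.
- move=> hex; have /and4P[pb qa _ _] := hex; have [pb' qa'] := (ltnW pb, ltnW qa).
  have [B BP tB] : exists2 B, B \in P & tri p q false \in B.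
    by apply: exP; rewrite tri_hexagon.
  have ntr : ~~ (has_top P p q && has_right P p q).
    apply/negP => /andP[/and3P[_ _ tP] /and3P[_ _ lP]].
    have /setP/(_ (tri p q true)) : top_tile p q = right_tile p q.
      by apply: (uniqP _ _ (tri p q false)); rewrite ?mem_top ?mem_right ?addn0 ?eqxx.
    by rewrite mem_top ?mem_right // !eqxx; lia.
  have ntl q' : q = q'.+1 -> ~~ (has_top P p q && has_left P p q').
    move=> pE; apply/negP => /andP[/and3P[_ _ tP] /and3P[_ pb2 lP]].
    have /setP/(_ (tri p q true)) : top_tile p q = left_tile p q'.
      by apply: (uniqP _ _ (tri p q false)); rewrite ?mem_top ?mem_left ?pE ?addn1 ?eqxx // -pE.
    by rewrite mem_top ?mem_left // !eqxx; lia.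
  have nrl q' : q = q'.+1 -> ~~ (has_right P p q && has_left P p q').
    move=> pE; apply/negP => /andP[/and3P[_ _ tP] /and3P[_ pb2 lP]].
    have /setP/(_ (tri p.+1 q true)) : right_tile p q = left_tile p q'.
      by apply: (uniqP _ _ (tri p q false)); rewrite ?mem_left ?mem_right ?pE ?addn0 ?addn1 ?eqxx // -pE.
    by rewrite mem_left ?mem_right // !eqxx; lia.
  have /existsP[p1 /existsP[q1 /or3P E]] := implyP (lozP B) BP.
  have [lp1 lq1] := (ltn_ord p1, ltn_ord q1).
  case: E => /eqP BE; move: tB; rewrite BE.
  + rewrite mem_top // => /andP[/eqP pE /eqP qE].
    have T : has_top P p q by rewrite /has_top pb qa pE qE -BE.
    move: ntr ntl; rewrite T /= => /negPf ->.
    by case: (q) => // q' /(_ q' erefl) /negPf ->.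
  + rewrite mem_left // addn1 => /andP[/eqP pE /eqP qE].
    have T : has_left P p q1 by rewrite /has_left lq1 pb pE -BE.
    move: (ntl _ qE) (nrl _ qE); rewrite T !andbT => /negPf -> /negPf ->.
    by rewrite qE T.
  + rewrite mem_right // addn0 => /andP[/eqP pE /eqP qE].
    have T : has_right P p q by rewrite /has_right pb qa pE qE -BE.
    move: ntr nrl; rewrite T andbT /= => /negPf ->.
    by case: (q) => // q' /(_ q' erefl) /negPf ->.
Qed.


Definition tiles_of (top left right : nat -> nat -> bool) : {set {set triangle a b c}} :=
  [set B | [exists p : 'I_(b + c), exists q : 'I_(a + c),
    [|| top p q && (B == top_tile p q), left p q && (B == left_tile p q)
      | right p q && (B == right_tile p q)]]].

Lemma tiles_ofP (top left right : nat -> nat -> bool) B :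
  reflect (exists p q, [/\ p < b + c, q < a + c &
             [\/ top p q /\ B = top_tile p q, left p q /\ B = left_tile p q
               | right p q /\ B = right_tile p q]])
          (B \in tiles_of top left right).
Proof.
rewrite inE; apply: (iffP existsP) => [[p /existsP[q /or3P E]]|[p [q [pb qa E]]]].
  exists p, q; split=> //; case: E => /andP[? /eqP ?];
    [exact: Or31|exact: Or32|exact: Or33].
exists (Ordinal pb); apply/existsP; exists (Ordinal qa) => /=.
by case: E => -[-> ->]; rewrite eqxx ?orbT.
Qed.

(** * From codes to tilings *)

Section FromCode.
Variables top left right : nat -> nat -> bool.
Hypothesis code : tiling_code top left right.
Local Notation tiles := (tiles_of top left right).

(** The lozenge covering a triangle. The last alternatives are reached by elimination; in the
    hexagon the code then ensures that the predecessor is genuine. *)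
Definition tile_at p q (d : bool) : {set triangle a b c} :=
  if top p q then top_tile p q
  else if d then (if left p q then left_tile p q else right_tile p.-1 q)
  else (if right p q then right_tile p q else left_tile p q.-1).

Lemma mem_tiles p q d : p <= b + c -> q <= a + c -> hextri p q d ->
  tile_at p q d \in tiles /\ tri p q d \in tile_at p q d.
Proof.
move=> pb qa hex; rewrite /tile_at.
case: ifP => [tpq|nt].
  have /andP[/and4P[pb1 qa1 _ _] _] := code_top code tpq.
  rewrite mem_top // !eqxx; split=> //.
  by apply/tiles_ofP; exists p, q; split=> //; apply: Or31.
case: d hex => hex; case: ifP => [lpq|nl].
- have /andP[/and4P[pb1 qa1 _ _] _] := code_left code lpq.
  rewrite mem_left // addn0 !eqxx; split=> //.
  by apply/tiles_ofP; exists p, q; split=> //; apply: Or32.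
- have := code_true code hex; rewrite nt nl; case: p => // p' in pb hex nt nl *.
  rewrite !add0n /=; case E: (right p' q) => // _.
  have /andP[/and4P[pb1 qa1 _ _] _] := code_right code E.
  rewrite mem_right // addn1 !eqxx; split=> //.
  by apply/tiles_ofP; exists p', q; split=> //; apply: Or33.
- have /andP[/and4P[pb1 qa1 _ _] _] := code_right code lpq.
  rewrite mem_right // addn0 !eqxx; split=> //.
  by apply/tiles_ofP; exists p, q; split=> //; apply: Or33.
- have := code_false code hex; rewrite nt nl; case: q => // q' in qa hex nt nl *.
  rewrite !add0n /=; case E: (left p q') => // _.
  have /andP[/and4P[pb1 qa1 _ _] _] := code_left code E.
  rewrite mem_left // addn1 !eqxx; split=> //.
  by apply/tiles_ofP; exists p, q'; split=> //; apply: Or32.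
Qed.

(** Yields disjointness: by the code, a chosen lozenge containing a triangle rules out the other two
    candidates, so it is the one that [tile_at] selects. *)
Lemma tiles_inj B p q d : p <= b + c -> q <= a + c ->
  B \in tiles -> tri p q d \in B -> hextri p q d /\ B = tile_at p q d.
Proof.
move=> pb qa /tiles_ofP[p1 [q1 [pb1 qa1 [] [X ->]]]]; rewrite /tile_at.
- rewrite mem_top // => /andP[/eqP-> /eqP->]; rewrite X.
  by have /andP[h1 h2] := code_top code X; split; first by case: d.
- have /andP[h1 h2] := code_left code X.
  rewrite mem_left // => /andP[/eqP-> /eqP->]; case: d; rewrite ?addn0 ?addn1;
    split=> //.
    by have := code_true code h1; rewrite X; case: (top p1 q1) => //; lia.
  have := code_false code h2; rewrite X.
  by case: (top p1 _); case: (right p1 _) => //; lia.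
- have /andP[h1 h2] := code_right code X.
  rewrite mem_right // => /andP[/eqP-> /eqP->]; case: d; rewrite ?addn0 ?addn1;
    split=> //.
    have := code_true code h2; rewrite X.
    by case: (top _ q1); case: (left _ q1) => //; lia.
  by have := code_false code h1; rewrite X; case: (top p1 q1) => //; lia.
Qed.

Lemma tiles_LT : tiles \in LT a b c.
Proof.
rewrite inE; apply/andP; split; last first.
  apply/forallP => B; apply/implyP => /tiles_ofP[p [q [pb qa E]]].
  apply/existsP; exists (Ordinal pb); apply/existsP; exists (Ordinal qa) => /=.
  by case: E => -[_ ->]; rewrite eqxx ?orbT.
apply/and3P; split.
- apply/eqP/setP => t; have [p [q [d [-> pb qa]]]] := tri_surj t.
  rewrite tri_hexagon //; apply/bigcupP/idP => [[B BP /tiles_inj[]]//|hex].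
  by exists (tile_at p q d); have [] := mem_tiles pb qa hex.
- apply/finset.trivIsetP => A B AP BP; apply: contraR => /pred0Pn[t /andP[/= tA tB]].
  have [p [q [d [tE pb qa]]]] := tri_surj t; rewrite tE in tA tB.
  by have [_ ->] := tiles_inj pb qa AP tA; have [_ ->] := tiles_inj pb qa BP tB.
- apply/negP => /tiles_ofP[p [q [pb qa E]]].
  have [pb1 qa1] := (ltnW pb, ltnW qa).
  case: E => -[_ /setP E].
  + by have := E (tri p q true); rewrite mem_top // !eqxx inE.
  + by have := E (tri p q true); rewrite mem_left // addn0 !eqxx inE.
  + by have := E (tri p q false); rewrite mem_right // addn0 !eqxx inE.
Qed.

(** A lozenge is only a set of triangles, but its two triangles determine its type and position. *)
Lemma has_top_tiles p q : has_top tiles p q = top p q.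
Proof.
apply/idP/idP => [/and3P[pb qa tP]|tpq].
  have [pb1 qa1] := (ltnW pb, ltnW qa).
  have t1 : tri p q true \in top_tile p q by rewrite mem_top ?eqxx.
  have t2 : tri p q false \in top_tile p q by rewrite mem_top ?eqxx.
  have [h1 _] := tiles_inj pb1 qa1 tP t1; have [h2 _] := tiles_inj pb1 qa1 tP t2.
  have /tiles_ofP[p1 [q1 [pb' qa' [] [X E]]]] := tP.
  - by move: t1; rewrite E mem_top // => /andP[/eqP-> /eqP->].
  - by move: t1 t2; rewrite E !mem_left //; lia.
  - by move: t1 t2; rewrite E !mem_right //; lia.
have /andP[/and4P[pb qa _ _] _] := code_top code tpq.
by rewrite /has_top pb qa; apply/tiles_ofP; exists p, q; split=> //; apply: Or31.
Qed.

Lemma has_left_tiles p q : has_left tiles p q = left p q.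
Proof.
apply/idP/idP => [/and3P[pb qa tP]|tpq].
  have [pb1 qa1] := (ltnW pb, ltnW qa).
  have t1 : tri p q true \in left_tile p q by rewrite mem_left ?addn0 ?eqxx.
  have t2 : tri p q.+1 false \in left_tile p q by rewrite mem_left ?addn1 ?eqxx.
  have /tiles_ofP[p1 [q1 [pb' qa' [] [X E]]]] := tP.
  - by move: t1 t2; rewrite E !mem_top //; lia.
  - by move: t1; rewrite E mem_left // addn0 => /andP[/eqP-> /eqP->].
  - by move: t1 t2; rewrite E !mem_right //; lia.
have /andP[/and4P[pb qa _ _] _] := code_left code tpq.
by rewrite /has_left pb qa; apply/tiles_ofP; exists p, q; split=> //; apply: Or32.
Qed.

End FromCode.

Lemma tiles_ofK P : P \in LT a b c ->
  tiles_of (has_top P) (has_left P) (has_right P) = P.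
Proof.
move=> PLT; apply/setP => B; apply/tiles_ofP/idP => [[p [q [_ _ []]]]|BP].
- by move=> [/and3P[_ _ +] ->].
- by move=> [/and3P[_ _ +] ->].
- by move=> [/and3P[_ _ +] ->].
move: PLT; rewrite inE => /andP[_ /forallP/(_ B)/implyP/(_ BP)].
move=> /existsP[p /existsP[q E]]; exists p, q; split=> //.
rewrite /has_top /has_left /has_right !ltn_ord /=.
by case/or3P: E => /eqP BE; rewrite -BE; [apply: Or31|apply: Or32|apply: Or33].
Qed.

Lemma eq_tiles_of (top left right top' left' right' : nat -> nat -> bool) :
  top =2 top' -> left =2 left' -> right =2 right' ->
  tiles_of top left right = tiles_of top' left' right'.
Proof.
move=> tE lE rE; apply/setP => B; rewrite !inE.
by apply: eq_existsb => p; apply: eq_existsb => q; rewrite tE lE rE.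
Qed.

End TilingCodes.

(** * Height functions *)

Section Heights.
Local Open Scope nat_scope.
Variables a b c : nat.

Local Notation hextri := (hextri a b c).
Local Notation inhex p q := (in_hexagon a b c (p, q)).
Local Notation tiling_code := (tiling_code a b c).

(* The bounds determine the values on the boundary of the hexagon. *)
Record height_fun (Z : nat -> nat -> nat) : Prop := HeightFun {
  height_step_p p q : inhex p q -> inhex p.+1 q -> Z p q <= Z p.+1 q;
  height_step_q p q : inhex p q -> inhex p q.+1 -> Z p q <= Z p q.+1;
  height_step_pq p q : inhex p q -> inhex p.+1 q.+1 -> Z p.+1 q.+1 <= (Z p q).+1;
  height_bounds p q : inhex p q ->
    [/\ p <= Z p q + b, q <= Z p q + a, Z p q <= p, Z p q <= q & Z p q <= c] }.

(** Surface edges in the x- and y-directions are level and vertical ones rise by one. A lozenge is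
    recognized by the opposite behaviour along the common side of its two triangles. *)
Definition top_of (Z : nat -> nat -> nat) p q :=
  [&& hextri p q true, hextri p q false & Z p.+1 q.+1 == Z p q].
Definition left_of (Z : nat -> nat -> nat) p q :=
  [&& hextri p q true, hextri p q.+1 false & Z p.+1 q.+1 == (Z p q.+1).+1].
Definition right_of (Z : nat -> nat -> nat) p q :=
  [&& hextri p q false, hextri p.+1 q true & Z p.+1 q.+1 == (Z p.+1 q).+1].

(** In a unit triangle the vertical step, 0 or 1, is the sum of the two other steps, both
    nonnegative. So exactly one side is the inner edge of a lozenge, and the bounds keep it off the
    boundary of the hexagon. *)
Lemma height_code Z : height_fun Z ->
  tiling_code (top_of Z) (left_of Z) (right_of Z).
Proof.
case=> Zp Zq Zpq Zb; split=> p q.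
- by case/and3P=> -> ->.
- by case/and3P=> -> ->.
- by case/and3P=> -> ->.
- move=> hex; rewrite /top_of /left_of hex /=.
  have h00 : inhex p q by move: hex; rewrite /hextri /in_hexagon /=; lia.
  have h01 : inhex p q.+1 by move: hex; rewrite /hextri /in_hexagon /=; lia.
  have h11 : inhex p.+1 q.+1 by move: hex; rewrite /hextri /in_hexagon /=; lia.
  have := Zq _ _ h00 h01; have := Zp _ _ h01 h11; have := Zpq _ _ h00 h11.
  have [] := Zb _ _ h00; have [] := Zb _ _ h01; have [] := Zb _ _ h11.
  case: p hex h00 h01 h11 => [|p] hex h00 h01 h11; last rewrite /right_of hex /=.
    by move: hex; rewrite /hextri; do 2!case: eqP; lia.
  by move: hex; rewrite /hextri; do 3!case: eqP; lia.
- move=> hex; rewrite /top_of /right_of hex /=.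
  have h00 : inhex p q by move: hex; rewrite /hextri /in_hexagon /=; lia.
  have h10 : inhex p.+1 q by move: hex; rewrite /hextri /in_hexagon /=; lia.
  have h11 : inhex p.+1 q.+1 by move: hex; rewrite /hextri /in_hexagon /=; lia.
  have := Zp _ _ h00 h10; have := Zq _ _ h10 h11; have := Zpq _ _ h00 h11.
  have [] := Zb _ _ h00; have [] := Zb _ _ h10; have [] := Zb _ _ h11.
  case: q hex h00 h10 h11 => [|q] hex h00 h10 h11; last rewrite /left_of hex ?andbT /=.
    by move: hex; rewrite /hextri; do 2!case: eqP; lia.
  by move: hex; rewrite /hextri; do 3!case: eqP; lia.
Qed.

(* Climbing vertically, each step up that is not the diagonal of a top tile
   raises the surface by one. *)
Fixpoint climb (top : nat -> nat -> bool) p q : nat :=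
  match p, q with
  | p'.+1, q'.+1 => climb top p' q' + ~~ top p' q'
  | _, _ => 0
  end.

Lemma climbS top p q : climb top p.+1 q.+1 = climb top p q + ~~ top p q.
Proof. by []. Qed.

Lemma climb_height Z : height_fun Z ->
  forall p q, inhex p q -> climb (top_of Z) p q = Z p q.
Proof.
case=> Zp Zq Zpq Zb; elim=> [|p IHp] [|q] hex; have [? ? ? ? ?] := Zb _ _ hex; [rewrite /=; lia..|].
have h00 : inhex p q by move: hex; rewrite /in_hexagon /=; lia.
rewrite /= IHp // /top_of.
have h10 : hextri p q false -> inhex p.+1 q.
  by move: hex; rewrite /hextri /in_hexagon /=; lia.
have s1 (hf : hextri p q false) : Z p q <= Z p.+1 q.+1.
  by apply: leq_trans (Zp _ _ h00 (h10 hf)) (Zq _ _ (h10 hf) hex).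
have := Zpq _ _ h00 hex.
have [] := Zb _ _ h00.
(* If a triangle beside the vertical edge is missing, the edge is on the boundary, where the bounds
   force a rise by one. *)
case E1: (hextri p q true); case E2: (hextri p q false) => /=.
- by have := s1 E2; case: eqP; lia.
- by move: E1 E2 hex; rewrite /hextri /in_hexagon /=; lia.
- by move: E1 E2 hex; rewrite /hextri /in_hexagon /=; lia.
- by move: E1 E2 hex; rewrite /hextri /in_hexagon /=; lia.
Qed.

(** * The height function of a code *)

Section ClimbCode.
Variables top left right : nat -> nat -> bool.
Hypothesis code : tiling_code top left right.

(** Induction along the vertical direction: the two triangles between consecutive steps form a left
    lozenge, whose indicator cancels when their code conditions are subtracted. *)
Lemma climb_q p q : inhex p q -> inhex p q.+1 ->
  climb top p q.+1 = climb top p q + (if p is p'.+1 then right p' q else false).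
Proof.
elim: p q => [|p IHp] [|q] // h0 h1.
  have hf : hextri p 0 false by move: h0 h1; rewrite /hextri /in_hexagon /=; lia.
  rewrite /=; have := code_false code hf.
  by clear IHp h0 h1 hf; case: p => [|p] /=; case: top; case: right; lia.
have hf : hextri p q.+1 false by move: h0 h1; rewrite /hextri /in_hexagon /=; lia.
have ht : hextri p q true by move: h0 h1; rewrite /hextri /in_hexagon /=; lia.
have h0' : inhex p q by move: h0 h1; rewrite /in_hexagon /=; lia.
have h1' : inhex p q.+1 by move: h0 h1; rewrite /in_hexagon /=; lia.
have := code_false code hf; have := code_true code ht; have := IHp _ h0' h1'.
rewrite !climbS => ->.
by case: (top p q); case: (top p q.+1); lia.
Qed.

Lemma climb_p p q : inhex p q -> inhex p.+1 q ->
  climb top p.+1 q = climb top p q + (if q is q'.+1 then left p q' else false).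
Proof.
elim: q p => [|q IHq] [|p] // h0 h1.
  have hf : hextri 0 q true by move: h0 h1; rewrite /hextri /in_hexagon /=; lia.
  rewrite /=; have := code_true code hf.
  by clear IHq h0 h1 hf; case: q => [|q] /=; case: top; case: left; lia.
have hf : hextri p.+1 q true by move: h0 h1; rewrite /hextri /in_hexagon /=; lia.
have ht : hextri p q false by move: h0 h1; rewrite /hextri /in_hexagon /=; lia.
have h0' : inhex p q by move: h0 h1; rewrite /in_hexagon /=; lia.
have h1' : inhex p.+1 q by move: h0 h1; rewrite /in_hexagon /=; lia.
have := code_true code hf; have := code_false code ht; have := IHq _ h0' h1'.
rewrite (climbS _ p.+1) (climbS _ p) => ->.
by case: (top p q); case: (top p.+1 q); lia.
Qed.

Lemma climb_le p q : climb top p q <= p /\ climb top p q <= q.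
Proof.
elim: p q => [|p IHp] [|q] //=; have [? ?] := IHp q.
by case: (top p q); lia.
Qed.

(** Along the side [p = q + b] no top tile fits, so every vertical step rises; elsewhere [climb_q]
    gives monotonicity in [q]. *)
Lemma climb_ge_p p q : inhex p q -> p <= climb top p q + b.
Proof.
elim: q p => [|q IHq] p hex; first by move: hex; rewrite /in_hexagon /=; lia.
have [pq|qp] := ltnP p (q.+1 + b).
  have h0 : inhex p q by move: hex; rewrite /in_hexagon /=; lia.
  by have := IHq _ h0; rewrite climb_q //; lia.
case: p => // p in hex qp *.
have h0 : inhex p q by move: hex; rewrite /in_hexagon /=; lia.
have := IHq _ h0; rewrite /=; case E: (top p q); last by lia.
by have := code_top code E; rewrite /hextri; lia.
Qed.

Lemma climb_ge_q p q : inhex p q -> q <= climb top p q + a.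
Proof.
elim: p q => [|p IHp] q hex; first by move: hex; rewrite /in_hexagon /=; lia.
have [pq|qp] := ltnP q (p.+1 + a).
  have h0 : inhex p q by move: hex; rewrite /in_hexagon /=; lia.
  by have := IHp _ h0; rewrite climb_p //; lia.
case: q => // q in hex qp *.
have h0 : inhex p q by move: hex; rewrite /in_hexagon /=; lia.
have := IHp _ h0; rewrite /=; case E: (top p q); last by lia.
by have := code_top code E; rewrite /hextri; lia.
Qed.

(** On the side [q = a + c] the height is at most [p], and beyond [p = c] it stays constant because
    no left tile fits below that side. Monotonicity in [q] carries the bound down. *)
Lemma climb_le_c p q : inhex p q -> climb top p q <= c.
Proof.
have upper k : inhex k (a + c) -> climb top k (a + c) <= c.
  elim: k => [|k IHk] hex; first by have [] := climb_le 0 (a + c); lia.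
  have [kc|ck] := leqP k.+1 c; first by have [] := climb_le k.+1 (a + c); lia.
  have h0 : inhex k (a + c) by move: hex; rewrite /in_hexagon /=; lia.
  rewrite climb_p //; have := IHk h0.
  case qE: (a + c) => [|q']; first by lia.
  by case E: (left k q'); [have := code_left code E; rewrite /hextri; lia|lia].
move=> hex; have := hex; rewrite /in_hexagon => /and4P[/= _ qc _ _].
move: {2}(a + c - q) (erefl (a + c - q)) => n.
elim: n q hex qc => [|n IHn] q hex qc nE.
  have qE : q = a + c by lia.
  by rewrite qE in hex *; apply: upper.
have [qp|pq] := ltnP q (p + a); last by have [] := climb_le p q; lia.
have h1 : inhex p q.+1 by move: hex; rewrite /in_hexagon /=; lia.
by have := IHn q.+1 h1; rewrite climb_q //; lia.
Qed.

Lemma climb_height_fun : height_fun (climb top).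
Proof.
split=> p q h0; [move=> h1..|].
- by rewrite climb_p // leq_addr.
- by rewrite climb_q // leq_addr.
- by rewrite /=; case: (top p q); lia.
- have [? ?] := climb_le p q.
  by split=> //; [apply: climb_ge_p|apply: climb_ge_q|apply: climb_le_c].
Qed.

Lemma top_of_climb : top_of (climb top) =2 top.
Proof.
move=> p q; rewrite /top_of climbS; apply/and3P/idP => [[_ _]|tpq].
  by case: (top p q) => //=; lia.
by have /andP[-> ->] := code_top code tpq; rewrite tpq addn0.
Qed.

Lemma left_of_climb : left_of (climb top) =2 left.
Proof.
move=> p q; rewrite /left_of; apply/and3P/idP => [[ht hf]|lpq].
  rewrite climb_p; first by case: (left p q) => //=; lia.
  - by move: ht; rewrite /hextri /in_hexagon /=; lia.
  - by move: ht; rewrite /hextri /in_hexagon /=; lia.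
have /andP[ht hf] := code_left code lpq; split=> //.
rewrite climb_p ?lpq ?addn1 //.
- by move: ht; rewrite /hextri /in_hexagon /=; lia.
- by move: ht; rewrite /hextri /in_hexagon /=; lia.
Qed.

Lemma right_of_climb : right_of (climb top) =2 right.
Proof.
move=> p q; rewrite /right_of; apply/and3P/idP => [[hf ht]|rpq].
  rewrite climb_q; first by case: (right p q) => //=; lia.
  - by move: hf; rewrite /hextri /in_hexagon /=; lia.
  - by move: hf; rewrite /hextri /in_hexagon /=; lia.
have /andP[hf ht] := code_right code rpq; split=> //.
rewrite climb_q ?rpq ?addn1 //.
- by move: hf; rewrite /hextri /in_hexagon /=; lia.
- by move: hf; rewrite /hextri /in_hexagon /=; lia.
Qed.

End ClimbCode.

End Heights.

(** * Tilings and decreasing arrays *)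

Section ArrayHeights.
Local Open Scope nat_scope.
Variables a b c : nat.

Local Notation hextri := (hextri a b c).
Local Notation inhex p q := (in_hexagon a b c (p, q)).
Local Notation height_fun := (height_fun a b c).
Local Notation top_of := (top_of a b c).
Local Notation left_of := (left_of a b c).
Local Notation right_of := (right_of a b c).

Lemma leq_of_lt m n : (forall k, k < m -> k < n) -> m <= n.
Proof. by move=> mn; rewrite leqNgt; apply/negP => /mn; rewrite ltnn. Qed.

Lemma eq_of_lt m n : (forall k, (k < m) = (k < n)) -> m = n.
Proof. by move=> mn; apply/eqP; rewrite eqn_leq !leq_of_lt // => k; rewrite mn. Qed.

(* The array M encodes the pile containing the unit cube at (x, y, z) when
   y < entry M x z; the height above (p, q) counts the cubes on the line
   (x, y, z) = (b + z - p, a + z - q, z), those with x < 0 or y < 0 included. *)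
Definition arr_height (M : arr a b c) p q : nat :=
  cnt c (fun z => (b + z < p) || (a + z < q + entry M (b + z - p) z)).

Definition arr_of_height (Z : nat -> nat -> nat) : arr a b c :=
  mkarr a b c (fun x z => cnt a (fun y => z < Z (b + z - x) (a + z - y))).

Section OfArray.
Variable M : arr a b c.
Hypothesis dM : decr M.

(** The line of cubes runs along [(1, 1, 1)], so [decr M] makes membership in the pile closed
    downwards in [z]. *)
Lemma lt_arr_height p q z : (z < arr_height M p q) =
  (z < c) && ((b + z < p) || (a + z < q + entry M (b + z - p) z)).
Proof.
rewrite cnt_lt // => i; rewrite !addnS.
have [|pb] := leqP p (b + i); last by [].
move=> pb /orP[|]; first by lia.
rewrite subSn //; have := @decr_entry _ _ _ M (b + i - p) (b + i - p).+1 i i.+1 dM.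
lia.
Qed.

Lemma arr_height_p p q : arr_height M p q <= arr_height M p.+1 q.
Proof.
apply: leq_of_lt => z; rewrite !lt_arr_height => /andP[-> /=].
have [//|pb /=] := ltnP (b + z) p; first by rewrite ltnS => /ltnW ->.
have := @decr_entry _ _ _ M (b + z - p.+1) (b + z - p) z z dM.
by case: ltnP => //=; lia.
Qed.

Lemma arr_height_q p q : arr_height M p q <= arr_height M p q.+1.
Proof. by apply: leq_of_lt => z; rewrite !lt_arr_height; lia. Qed.

Lemma arr_height_pq p q : arr_height M p.+1 q.+1 <= (arr_height M p q).+1.
Proof.
apply: leq_of_lt => -[//|z]; rewrite ltnS !lt_arr_height !addnS subSS.
have := @decr_entry _ _ _ M (b + z - p) (b + z - p) z z.+1 dM; lia.
Qed.

Lemma arr_height_fun : height_fun (arr_height M).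
Proof.
split=> p q; [by move=> *; apply: arr_height_p|by move=> *; apply: arr_height_q
             |by move=> *; apply: arr_height_pq|].
rewrite /in_hexagon => /and4P[/= pb qa qp pq]; split.
- have [pb'|bp] := leqP p b; first by rewrite (leq_trans pb') // leq_addl.
  (* The largest [z] with [b + z < p], a position counted for its negative x. *)
  suff : p - b - 1 < arr_height M p q by lia.
  by rewrite lt_arr_height; lia.
- have [qa'|aq] := leqP q a; first by rewrite (leq_trans qa') // leq_addl.
  suff : q - a - 1 < arr_height M p q by lia.
  by rewrite lt_arr_height; lia.
- by rewrite leqNgt lt_arr_height (@entry_out _ _ _ _ (b + p - p)); lia.
- by rewrite leqNgt lt_arr_height; have := entry_le M (b + q - p) q; lia.
- exact: cnt_le.
Qed.

Lemma arr_heightK : arr_of_height (arr_height M) = M.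
Proof.
apply: entry_inj => x z xb zc; rewrite entry_mkarr ?cnt_le //.
transitivity (cnt a (fun y => y < entry M x z)); last first.
  by rewrite cnt_ltn; apply/minn_idPr/entry_le.
apply: eq_cnt => y ya; rewrite lt_arr_height zc /=.
by rewrite subKn; lia.
Qed.

End OfArray.

Section OfHeight.
Variable Z : nat -> nat -> nat.
Hypothesis hZ : height_fun Z.

Lemma lt_arr_of_height x z y : x < b -> z < c -> y < a ->
  (y < entry (arr_of_height Z) x z) = (z < Z (b + z - x) (a + z - y)).
Proof.
move=> xb zc ya; rewrite entry_mkarr ?cnt_le //.
(* The guard [k < a] confines the monotonicity check to points of the hexagon, where [Z] is
   constrained. *)
rewrite (@eq_cnt _ _ (fun k => (k < a) && (z < Z (b + z - x) (a + z - k)))).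
  rewrite cnt_lt ?ya // => k /andP[ka lt_z]; rewrite (ltnW ka) /=.
  apply: leq_trans lt_z _; have -> : a + z - k = (a + z - k.+1).+1 by lia.
  by apply: (height_step_q hZ); rewrite /in_hexagon /=; lia.
by move=> k ->.
Qed.

Lemma arr_of_height_decr : decr (arr_of_height Z).
Proof.
apply/decrP => x z; split; apply: leq_of_lt => y lt_y.
  have ya : y < a := leq_trans lt_y (entry_le _ _ _).
  have [xb|bx] := ltnP x.+1 b; last by rewrite entry_out in lt_y; lia.
  have [zc|cz] := ltnP z c; last by rewrite entry_out in lt_y; lia.
  move: lt_y; rewrite !lt_arr_of_height ?(ltnW xb) // => lt_z; apply: leq_trans lt_z _.
  have -> : b + z - x = (b + z - x.+1).+1 by lia.
  by apply: (height_step_p hZ); rewrite /in_hexagon /=; lia.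
have ya : y < a := leq_trans lt_y (entry_le _ _ _).
have [xb|bx] := ltnP x b; last by rewrite entry_out in lt_y; lia.
have [zc|cz] := ltnP z.+1 c; last by rewrite entry_out in lt_y; lia.
move: lt_y; rewrite !lt_arr_of_height ?(ltnW zc) // => lt_z; rewrite -ltnS.
apply: leq_trans lt_z _.
have -> : b + z.+1 - x = (b + z - x).+1 by lia.
have -> : a + z.+1 - y = (a + z - y).+1 by lia.
by apply: (height_step_pq hZ); rewrite /in_hexagon /=; lia.
Qed.

(** Outside the box the bounds on [Z] decide: positions with negative x or y lie below [Z p q],
    those with x at least [b] or y at least [a] do not. *)
Lemma arr_of_heightK p q : inhex p q -> arr_height (arr_of_height Z) p q = Z p q.
Proof.
move=> hex; apply: eq_of_lt => z; rewrite (lt_arr_height arr_of_height_decr).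
have [p_le q_le le_p le_q le_c] := height_bounds hZ hex.
have [zc|cz] /= := ltnP z c; last by apply/esym/negP; lia.
have [zp|pz] /= := ltnP (b + z) p; first by apply/esym; lia.
have [zq|qz] := ltnP (a + z) q; first by rewrite ltn_addr //; apply/esym; lia.
have [xb|bx] := ltnP (b + z - p) b; last by rewrite entry_out; lia.
have [ya|ay] := ltnP (a + z - q) a; last first.
  by have := entry_le (arr_of_height Z) (b + z - p) z; lia.
have := @lt_arr_of_height _ z _ xb zc ya.
have -> : b + z - (b + z - p) = p by lia.
have -> : a + z - (a + z - q) = q by lia.
by move=> <-; lia.
Qed.

End OfHeight.

Lemma eq_arr_of_height Z Z' : (forall p q, inhex p q -> Z p q = Z' p q) ->
  arr_of_height Z = arr_of_height Z'.
Proof.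
move=> ZZ'; apply: entry_inj => x z xb zc; rewrite !entry_mkarr ?cnt_le //.
by apply: eq_cnt => y ya; rewrite ZZ' // /in_hexagon /=; lia.
Qed.

Definition tiling_of (M : arr a b c) : {set {set triangle a b c}} :=
  tiles_of a b c (top_of (arr_height M)) (left_of (arr_height M)) (right_of (arr_height M)).

Definition arr_of_tiling (P : {set {set triangle a b c}}) : arr a b c :=
  arr_of_height (climb (has_top P)).

Lemma eq_climb (top top' : nat -> nat -> bool) : top =2 top' -> climb top =2 climb top'.
Proof. by move=> tt'; elim=> [|p IHp] [|q] //=; rewrite IHp tt'. Qed.

Lemma tiling_of_LT M : decr M -> tiling_of M \in LT a b c.
Proof. by move=> dM; apply/tiles_LT/height_code/arr_height_fun. Qed.

Lemma arr_of_tiling_decr P : P \in LT a b c -> decr (arr_of_tiling P).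
Proof. by move=> /LT_code/climb_height_fun/arr_of_height_decr. Qed.

Lemma has_top_tiling_of M : decr M -> has_top (tiling_of M) =2 top_of (arr_height M).
Proof.
by move=> dM p q; rewrite (has_top_tiles (height_code (arr_height_fun dM))).
Qed.

Lemma climb_tiling_of M p q : decr M -> inhex p q ->
  climb (has_top (tiling_of M)) p q = arr_height M p q.
Proof.
move=> dM hex; rewrite (eq_climb (has_top_tiling_of dM)).
by rewrite (climb_height (arr_height_fun dM)).
Qed.

Lemma tiling_ofK M : decr M -> arr_of_tiling (tiling_of M) = M.
Proof.
move=> dM; rewrite -[RHS]arr_heightK //.
by apply: eq_arr_of_height => p q; apply: climb_tiling_of.
Qed.

Lemma arr_of_tilingK P : P \in LT a b c -> tiling_of (arr_of_tiling P) = P.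
Proof.
move=> PLT; have code := LT_code PLT.
rewrite -[RHS](tiles_ofK PLT); have hZ := climb_height_fun code.
have ZE := arr_of_heightK hZ.
apply: eq_tiles_of => p q.
- rewrite -(top_of_climb code) /top_of.
  apply: andb_id2l => E1; apply: andb_id2l => E2.
  by rewrite !ZE //; move: E1 E2; rewrite /hextri /in_hexagon /=; lia.
- rewrite -(left_of_climb code) /left_of.
  apply: andb_id2l => E1; apply: andb_id2l => E2.
  by rewrite !ZE //; move: E1 E2; rewrite /hextri /in_hexagon /=; lia.
- rewrite -(right_of_climb code) /right_of.
  apply: andb_id2l => E1; apply: andb_id2l => E2.
  by rewrite !ZE //; move: E1 E2; rewrite /hextri /in_hexagon /=; lia.
Qed.

(** A vertical step adds to [height] the left or right tile covering the triangle to the left of the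
    edge; by the code there is one unless a top tile covers it. The condition [q < p + a] keeps this
    triangle in the hexagon. *)
Lemma height_climb P p q : P \in LT a b c -> inhex p q -> q < p + a ->
  height P p q = climb (has_top P) p q.
Proof.
move=> PLT; have code := LT_code PLT.
elim: p q => [|p IHp] [|q] hex qp.
- by apply: eq_card0 => v; rewrite inE ltn0.
- apply: eq_card0 => v; rewrite inE; apply/negP => /andP[vq].
  by case/orP => /andP[/eqP]; lia.
- by apply: eq_card0 => v; rewrite inE ltn0.
have h0 : inhex p q by move: hex; rewrite /in_hexagon /=; lia.
have ht : hextri p q true by move: hex qp; rewrite /hextri /in_hexagon /=; lia.
have [pb qa _ _] := and4P ht.
rewrite climbS -IHp //.
rewrite /height; set S := [set v | _].
set S0 := [set v : 'I_(b + c) * 'I_(a + c) | (v.2 < q) && _].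
have S0S : S0 \subset S.
  by apply/fintype.subsetP => v; rewrite !inE !addSn !addnS !eqSS => /andP[/leqW-> ->].
rewrite -(cardsID S0 S) (finset.setIidPr S0S); congr (_ + _).
pose N := [set v : 'I_(b + c) * 'I_(a + c) | (v.2 == q :> nat)
  && (((v.1 == p :> nat) && has_left P p q) || ((v.1.+1 == p) && has_right P v.1 q))].
have -> : S :\: S0 = N.
  apply/setP => v; rewrite !inE /has_left /has_right ltn_ord pb qa /=.
  rewrite !addSn !addnS !eqSS ltnS.
  have [vq|vq|vq] := ltngtP (v.2 : nat) q; rewrite /= ?andNb ?andbF //.
  rewrite vq -addSn !eqn_add2r ![p == _]eq_sym.
  by case: eqP => [->|].
have := code_true code ht.
case: (has_top P p q) => /= [|]; rewrite ?add0n ?add1n => nlr.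
  apply: eq_card0 => v; rewrite inE; apply/negP => /andP[_ /orP[] /andP[/eqP vp lr]].
    by move: nlr; rewrite lr.
  by move: nlr; rewrite -vp lr addn1.
have [lpq|nl] := boolP (has_left P p q).
  rewrite (_ : N = [set (Ordinal pb, Ordinal qa)]) ?cards1 //.
  apply/setP => v; rewrite !inE -pair_eqE /pair_eq /= -!val_eqE /= lpq andbT andbC.
  have [vp|_] := eqVneq (v.1 : nat) p; rewrite //=.
  apply/negbTE/negP => /andP[/andP[/eqP vp r] _].
  by move: nlr; rewrite lpq -vp r.
have [p' pE r] : exists2 p', p = p'.+1 & has_right P p' q.
  move: nlr; rewrite (negPf nl); case: (p) => // p'; exists p' => //.
  by case: (has_right P p' q) nlr.
have pb' : p' < b + c by rewrite pE in pb; apply: ltnW.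
rewrite (_ : N = [set (Ordinal pb', Ordinal qa)]) ?cards1 //.
apply/setP => v; rewrite !inE -pair_eqE /pair_eq /= -!val_eqE /= (negPf nl) andbF pE eqSS.
by rewrite andbC; case: eqP => //= ->; rewrite r.
Qed.

(** [left_corner] may test a top tile at the limit of the index range. Its left triangle is still
    genuine, and lying in the hexagon it satisfies the strict bounds. *)
Lemma has_topE P p q : P \in LT a b c -> p <= b + c -> q <= a + c ->
  (top_tile a b c p q \in P) = has_top P p q.
Proof.
move=> PLT pb qa; apply/idP/and3P => [tP|[]//].
suff /and4P[-> -> _ _] : hextri p q true by [].
move: PLT; rewrite inE -tri_hexagon // => /andP[/and3P[/eqP <- _ _] _].
by apply/bigcupP; exists (top_tile a b c p q); rewrite ?set21.
Qed.

Lemma left_corner_tiling_of M p q : decr M -> p < b + c -> q < a + c ->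
  left_corner (tiling_of M) p q
  = top_of (arr_height M) p.+1 q.+1 && left_of (arr_height M) p q.
Proof.
move=> dM pb qa; rewrite /left_corner (has_topE (tiling_of_LT dM)) //.
rewrite has_top_tiling_of // -(has_left_tiles (height_code (arr_height_fun dM))).
by rewrite /has_left pb qa.
Qed.

Lemma corner_heights M p q z : decr M -> p < b + c -> q < a + c ->
  left_corner (tiling_of M) p q && (height (tiling_of M) p.+1 q.+1 == z.+1)
  = [&& left_of (arr_height M) p q, top_of (arr_height M) p.+1 q.+1
      & arr_height M p.+1 q.+1 == z.+1].
Proof.
move=> dM pb qa; rewrite left_corner_tiling_of // andbC.
case: (boolP (top_of _ _ _)) => [|_]; last by rewrite /= !andbF.
case: (boolP (left_of _ _ _)) => [|_]; last by rewrite /= andbF.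
move=> /and3P[_ hf _] /and3P[ht _ _]; rewrite /= andbT.
have hex : inhex p.+1 q.+1 by move: ht; rewrite /hextri /in_hexagon /=; lia.
rewrite (height_climb (tiling_of_LT dM)) ?climb_tiling_of //.
by move: ht; rewrite /hextri; lia.
Qed.

Lemma corner_incrE (M : arr a b c) x z : corner_incr M x z =
  \sum_(y < a) [&& y < entry M x z, entry M x.+1 z <= y & entry M x z.+1 <= y].
Proof.
rewrite /corner_incr; set A := entry M x z; set B := maxn _ _.
have AE : A = cnt a (fun y => y < A) by rewrite cnt_ltn; apply/esym/minn_idPr/entry_le.
have BE : minn A B = cnt a (fun y => y < minn A B).
  by rewrite cnt_ltn; apply/esym/minn_idPr; have := entry_le M x z; rewrite -/A; lia.
(* Capping the maximum at [A] makes the subtraction exact. *)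
have -> : A - B = A - minn A B by lia.
apply/eqP; rewrite -(eqn_add2r (minn A B)) subnK; last by lia.
rewrite {1}AE {1}BE -big_split /=; apply/eqP; apply: eq_bigr => y _.
by rewrite /B; lia.
Qed.

(* A left corner consists of two faces of the unit cube at (x, y, z). *)
Lemma corner_cube M x y z : decr M -> x < b -> y < a -> z < c ->
  [&& y < entry M x z, entry M x.+1 z <= y & entry M x z.+1 <= y]
  = [&& left_of (arr_height M) (b + z - x.+1) (a + z - y.+1),
        top_of (arr_height M) (b + z - x.+1).+1 (a + z - y.+1).+1
      & arr_height M (b + z - x.+1).+1 (a + z - y.+1).+1 == z.+1].
Proof.
move=> dM xb ya zc; set p := b + z - x.+1; set q := a + z - y.+1.
have ZE := lt_arr_height dM.
(* These instances decide whether the cubes [(x, y, z)], [(x+1, y, z)] and [(x, y, z+1)] belong to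
   the pile. *)
have := ZE p.+1 q.+1 z; have := ZE p q.+1 z; have := ZE p.+2 q.+2 z.+1.
have -> : b + z.+1 - p.+2 = x by rewrite /p; lia.
have -> : b + z - p = x.+1 by rewrite /p; lia.
have -> : b + z - p.+1 = x by rewrite /p; lia.
have -> : (z.+1 < c) && ((b + z.+1 < p.+2) || (a + z.+1 < q.+2 + entry M x z.+1))
          = (y < entry M x z.+1).
  by have [zc'|cz] := ltnP z.+1 c; rewrite /p /q; [|rewrite entry_out]; lia.
have -> : (z < c) && ((b + z < p) || (a + z < q.+1 + entry M x.+1 z))
          = (y < entry M x.+1 z) by rewrite /p /q; lia.
have -> : (z < c) && ((b + z < p.+1) || (a + z < q.+1 + entry M x z))
          = (y < entry M x z) by rewrite /p /q; lia.
rewrite ![_ <= y]leqNgt => <- <- <-.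
have := arr_height_p dM p.+1 q.+1; have := arr_height_q dM p.+2 q.+1.
have := arr_height_pq dM p q; have := arr_height_q dM p q.
have -> : left_of (arr_height M) p q = (arr_height M p.+1 q.+1 == (arr_height M p q.+1).+1).
  by rewrite /left_of /hextri /p /q; lia.
have -> : top_of (arr_height M) p.+1 q.+1 = (arr_height M p.+2 q.+2 == arr_height M p.+1 q.+1).
  by rewrite /top_of /hextri /p /q; lia.
by lia.
Qed.

(** Places the cube of the corner in the box: solving [p = b + z - x.+1] and [q = a + z - y.+1]
    gives [x < b] and [y < a]. *)
Lemma corner_bounds M p q z : decr M ->
  left_of (arr_height M) p q -> top_of (arr_height M) p.+1 q.+1 ->
  arr_height M p.+1 q.+1 = z.+1 ->
  [&& z <= p, p < b + z, z <= q & q < a + z].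
Proof.
move=> dM _ /and3P[ht hf /eqP E2] E1; have hZ := arr_height_fun dM.
have h1 : inhex p.+1 q.+1 by move: ht; rewrite /hextri /in_hexagon /=; lia.
have h2 : inhex p.+2 q.+2 by move: ht; rewrite /hextri /in_hexagon /=; lia.
have [_ _ ? ? _] := height_bounds hZ h1; have [? ? _ _ _] := height_bounds hZ h2.
lia.
Qed.

(** At fixed [z] the projection of the cubes is injective, so corners match cubes. The top face of a
    cube at level [z] has height [z.+1]. *)
Lemma Gamma_tiling_of M z : decr M -> z < c ->
  Gamma (tiling_of M) z.+1 = \sum_(x < b) corner_incr M x z.
Proof.
move=> dM zc.
have pb (x : nat) : b + z - x.+1 < b + c by lia.
have qa (y : nat) : a + z - y.+1 < a + c by lia.
pose f (u : 'I_b * 'I_a) := (Ordinal (pb u.1), Ordinal (qa u.2)).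
have f_inj : injective f.
  move=> [x y] [x' y'] [/= xx yy]; have := ltn_ord x; have := ltn_ord x'.
  have := ltn_ord y; have := ltn_ord y'.
  by move=> *; congr (_, _); apply: val_inj => /=; lia.
under eq_bigr do rewrite corner_incrE.
rewrite pair_bigA /= /Gamma.
pose S := [set u : 'I_b * 'I_a | [&& u.2 < entry M u.1 z,
  entry M u.1.+1 z <= u.2 & entry M u.1 z.+1 <= u.2]].
transitivity #|S|; last first.
  by rewrite -sum1dep_card big_mkcond; apply: eq_bigr => u _; case: ifP.
rewrite -(card_imset _ f_inj); apply: eq_card => v; rewrite inE corner_heights //.
apply/idP/imsetP => [corner|[[x y] uS ->]]; last first.
  by move: uS; rewrite inE corner_cube.
have /and3P[l t /eqP E] := corner.
have /and4P[zp pz zq qz] := corner_bounds dM l t E.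
have lt_sub m n : z <= n -> n < m + z -> m + z - n.+1 < m by lia.
have sub_subK m n : n < m + z -> m + z - (m + z - n.+1).+1 = n by lia.
exists (Ordinal (lt_sub _ _ zp pz), Ordinal (lt_sub _ _ zq qz)).
  by rewrite inE corner_cube //= ?lt_sub // !sub_subK.
by rewrite [LHS]surjective_pairing; congr (_, _); apply: val_inj; rewrite /= sub_subK.
Qed.

End ArrayHeights.

(** * Generating functions *)

Lemma pgf_unif (R : fieldType) (T : finType) (Omega : {set T}) n
    (G : T -> 'I_n -> nat) (x : 'I_n -> R) :
  \sum_(gamma \in [set: {ffun 'I_n -> nat}]%classic)
     unif_prob R Omega (fun w => [forall l, G w l == gamma l])
     * \prod_(l < n) x l ^+ gamma l
  = (\sum_(w in Omega) \prod_(l < n) x l ^+ G w l) / #|Omega|%:R.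
Proof.
pose g w : {ffun 'I_n -> nat} := [ffun l => G w l].
have gE w (gamma : {ffun 'I_n -> nat}) : [forall l, G w l == gamma l] = (g w == gamma).
  apply/forallP/eqP => [Gg|<- l]; last by rewrite ffunE.
  by apply/ffunP => l; rewrite ffunE (eqP (Gg l)).
have probE (gamma : {ffun 'I_n -> nat}) :
    unif_prob R Omega (fun w => [forall l, G w l == gamma l])
    = (\sum_(w in Omega) (g w == gamma)%:R) / #|Omega|%:R.
  rewrite /unif_prob -sum1dep_card natr_sum big_mkcondr /=; congr (_ / _).
  by apply: eq_bigr => w _; rewrite gE; case: eqP.
(* Only values taken on [Omega] have nonzero probability, so the sum over all [gamma] has finite
   support. *)
rewrite (fsbigE (undup [seq g w | w in Omega])) ?undup_uniq //; last first.
  move=> gamma _; rewrite mem_undup => /negP gam.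
  rewrite probE big1 ?mul0r // => w Ow; case: eqP => // gw.
  by case: gam; rewrite -gw; apply: fintype.image_f.
under eq_bigl do rewrite in_setT.
under eq_bigr do rewrite probE mulrAC big_distrl /=.
rewrite -big_distrl exchange_big /=; congr (_ / _); apply: eq_bigr => w Ow.
have gw : g w \in undup [seq g w | w in Omega] by rewrite mem_undup fintype.image_f.
rewrite (bigD1_seq _ gw (undup_uniq _)) /= eqxx mul1r.
rewrite [X in _ + X]big1 ?addr0 => [|gamma /negPf ne]; last by rewrite eq_sym ne mul0r.
by apply: eq_bigr => l _; rewrite ffunE.
Qed.

Lemma sum_LT (R : comNzRingType) (a b c : nat) (x : 'I_c -> R) :
  \sum_(P in LT a b c) \prod_(l < c) x l ^+ Gamma P l.+1
  = gen_fun x (fun (M : arr a b c) l => \sum_(i < b) corner_incr M i l)%N.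
Proof.
rewrite (reindex_onto (@tiling_of a b c) (@arr_of_tiling a b c)); last first.
  by move=> P; apply: arr_of_tilingK.
apply: eq_big => [M|M /andP[PM /eqP MK]].
  apply/andP/idP => [[/arr_of_tiling_decr dM /eqP <-] //|dM].
  by rewrite tiling_of_LT // tiling_ofK.
have dM : decr M by rewrite -MK arr_of_tiling_decr.
by apply: eq_bigr => l _; rewrite Gamma_tiling_of.
Qed.

Theorem theorem1p3 (R : numFieldType) (a b c : nat)
    (ha : (0 < a)%N) (hb : (0 < b)%N) (hc : (0 < c)%N) (x : 'I_c -> R) :
  \sum_(gamma \in [set: {ffun 'I_c -> nat}]%classic)
     unif_prob R (LT a b c)
       (fun P => [forall l : 'I_c, Gamma P l.+1 == gamma l])
     * \prod_(l < c) x l ^+ gamma l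
  = (schur R (b + c) (nseq b a)).@[fun i =>
       match split i with inl _ => 1 | inr l => x l end]
    / (schur R (b + c) (nseq b a)).@[fun => 1].
Proof.
(* Holding for every [y], this gives the numerator at [y = x] and the number of tilings at
   [y = 1]. *)
have schurE (y : 'I_c -> R) : (schur R (b + c) (nseq b a)).@[fun i =>
       match split i with inl _ => 1 | inr l => y l end]
    = \sum_(P in LT a b c) \prod_(l < c) y l ^+ Gamma P l.+1.
  by rewrite sum_LT gen_fun_corner_diag schur_rect.
rewrite pgf_unif schurE; congr (_ / _).
transitivity (schur R (b + c) (nseq b a)).@[fun i =>
    match split i with inl _ => 1 | inr l => (fun => 1) l end]; last first.
  by apply: meval_eq => i; case: split.
rewrite schurE -sum1_card natr_sum; apply: eq_bigr => P _.
by rewrite big1 // => l _; rewrite expr1n.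
Qed.
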